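(* Let $A\subset \mathbb{Z}\setminus\{0\}$ be a finite set of non-zero integers and let $k\geq 1$ be a fixed integer. If $\omega(n)\leq k$ for all $n\in A$, then $$\max(|A+A|,|AA|)\gg |A|^{12/7-o(1)}$$ and $$\max(|A-A|,|AA|)\gg |A|^{12/7-o(1)}.$$
   Context: For a non-zero integer $n$, $\omega(n)$ is the number of distinct primes dividing $n$. $A+A=\{a+b: a,b\in A\}$, $A-A=\{a-b:a,b\in A\}$, $AA=\{ab:a,b\in A\}$. Here $o(1)$ denotes a quantity tending to $0$ as $|A|\to\infty$ with $k$ fixed; that is, for every $k\geq 1$ and $\epsilon>0$ there is a constant $c=c(k,\epsilon)>0$ such that every $A$ as in the statement satisfies both bounds with right-hand side $c|A|^{12/7-\epsilon}$. *)

(* Defs.v *)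
From mathcomp Require Import all_boot all_order all_algebra.
From mathcomp Require Import finmap.
From mathcomp Require Import reals exp.

Set Implicit Arguments.
Unset Strict Implicit.
Unset Printing Implicit Defensive.

Import Order.TTheory GRing.Theory Num.Theory.

Local Open Scope fset_scope.
Local Open Scope ring_scope.

(* The number of distinct primes dividing n. [primes] is duplicate-free;
   the value at n = 0 is the junk value 0. *)
Definition omega (n : int) : nat := size (primes `|n|%N).

Definition sumset (A B : {fset int}) : {fset int} :=
  [fset a + b | a in A, b in B].

Definition diffset (A B : {fset int}) : {fset int} :=
  [fset a - b | a in A, b in B].

Definition prodset (A B : {fset int}) : {fset int} :=
  [fset a * b | a in A, b in B].

(* Main.v *)
Require Import Defs.
From mathcomp Require Import all_boot all_order all_algebra.
From mathcomp Require Import finmap zify lra.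
From mathcomp Require Import reals exp.

(** Write [n] for the number of elements of [A].  The exponent 12/7 comes out
    with room to spare: for every [e] the larger of the two sets has at least
    [n ^ (2 - 1/e)] elements up to a constant ([few_primes_sum_product]), and
    [e = 4] is used.  Everything rests on elementary p-adic counting.  Below,
    [q] is a small power of [n], the number of steps is bounded in terms of
    [k], and every loss is a bounded power of [q].

    Few representations.  Fix a prime [p] and view a finite set of integers as
    a tree, the nodes of level [j] being its classes modulo [p ^ j].  A level
    is light for an element if, in passing from its class modulo [p ^ j] to
    its class modulo [p ^ j.+1], more than the fraction [1/q] of the elements
    is lost; otherwise it is heavy.  An element has few light levels, since
    each costs a factor [1 - 1/q].  Suppose [x1 + x2 = x3 + x4].  Then [x1 - x3] and [x4 - x2] have
    the same valuation [j], and of two elements that separate at level [j] at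
    least one is light there, because two disjoint subclasses cannot both be
    almost everything.  If [x1], [x2] have no common light level, and neither
    have [x3], [x4], then the only possibility is that one pair is (light,
    heavy) and the other is (heavy, light).  So representations of one sum
    branch in two at most, and each branch loses a factor [q] in one of the
    two trees; hence there are boundedly many of them ([separated_card]).

    Separating the popular primes.  Restrict [A] to a dense subset such that
    for a set [S] of at most [k] primes, every prime outside [S] divides only
    a small proportion of the elements ([popular_primes]).  Split each element
    as [x = g y], where [g] is made of primes of [S] and [y] is free of them.
    If [y] determined [x], the product set would be large: almost all pairs
    would have coprime parts [y1], [y2], and the product [x1 x2] shows [y1 y2],
    which has few coprime factorizations ([prodset_large]).

    Sums, or determination by [y].  Compare pairs with prescribed [g1], [g2]
    through the tree of the numbers [y]; scaling by [g1] and [g2] shifts its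
    levels by the valuations of [g1] and [g2].  If most pairs have no common
    level after the shifts, for each prime of [S], then the sumset is large
    ([sumset_large]).  Otherwise one level [j] is popular: for a dense set of
    elements, [j] is the valuation of [x] at some [p] in [S], or this
    valuation plus a light level of [y].  As [y] has few light levels, it leaves few values for that
    valuation, and on a dense subset the valuation at [p] is a function of [y]
    ([passive_fixes_valuation]).  Then [p] is moved from [g] to [y] and the
    argument is repeated.  After at most [k] rounds the sumset is large or
    [y] determines [x] ([sumset_large_or_passive_inj]).

    For the sumset one also has to know that a sum determines [g1] and [g2].
    If the valuations of [x1] and [x2] differ, the sum shows the smaller one.
    If there were two possibilities for the larger one, the lesser of the two
    would be the valuation of [x1 - x3], hence a light level of [x1] or [x3] in
    the tree of [A]; this is excluded on a dense set of pairs
    ([sum_fixes_valuations]).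

    Differences are sums with the second summand negated, which changes neither
    the trees nor the valuations. *)

Set Implicit Arguments.
Unset Strict Implicit.
Unset Printing Implicit Defensive.

Import Order.TTheory GRing.Theory Num.Theory.

Local Open Scope nat_scope.

(** * Trees of residue classes *)

Section Balls.
Variables (T : finType) (p q : nat) (A : {set T}).
Hypothesis p_prime : prime p.
Implicit Types (h : T -> int) (x y z : T) (j : nat).

Definition ball h j x : {set T} :=
  [set y in A | ((p ^ j)%N%:Z %| (h x - h y)%R)%Z].

Definition level_bound h := \max_x \max_y absz (h x - h y)%R.

(** The bound on the levels makes this a finite list; it omits nothing, see
    [mem_light]. *)
Definition light h x : seq nat :=
  [seq j <- iota 0 (level_bound h) | q * #|ball h j.+1 x| < q.-1 * #|ball h j x|].

Definition split_level h x y := logn p (absz (h x - h y)%R).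

Lemma ballS h i j x : i <= j -> ball h j x \subset ball h i x.
Proof.
move=> ij; apply/subsetP=> y; rewrite !inE => /andP[-> /=].
apply: dvdz_trans; rewrite dvdzE /=; exact: dvdn_exp2l.
Qed.

Lemma ball0 h x : ball h 0 x = A.
Proof. by apply/setP=> y; rewrite !inE expn0 dvd1z andbT. Qed.

Lemma ball_self h j x : x \in A -> x \in ball h j x.
Proof. by move=> Ax; rewrite inE Ax subrr dvdz0. Qed.

Lemma ball_gt0 h j x : x \in A -> 0 < #|ball h j x|.
Proof. by move=> Ax; apply/card_gt0P; exists x; exact: ball_self. Qed.

Lemma ball_eq h j x y : ((p ^ j)%N%:Z %| (h x - h y)%R)%Z -> ball h j x = ball h j y.
Proof.
move=> xy; apply/setP=> z; rewrite !inE; congr (_ && _).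
by rewrite -(subrKA (h y)) rpredDl.
Qed.

Lemma dvd_split_level h j x y : h x != h y -> (((p ^ j)%N%:Z %| (h x - h y)%R)%Z) = (j <= split_level h x y).
Proof.
move=> xy; rewrite dvdzE /= pfactor_dvdn //.
by rewrite absz_gt0 subr_eq0.
Qed.

Lemma split_ball_eq h x y : h x != h y ->
  ball h (split_level h x y) x = ball h (split_level h x y) y.
Proof. by move=> xy; apply: ball_eq; rewrite dvd_split_level. Qed.

Lemma split_ball_disjoint h x y : h x != h y ->
  [disjoint ball h (split_level h x y).+1 x & ball h (split_level h x y).+1 y].
Proof.
move=> xy; rewrite -setI_eq0; apply/eqP/setP=> z; rewrite !inE.
apply/negP=> /andP[/andP[_ xz] /andP[_ yz]].
have : ((p ^ (split_level h x y).+1)%N%:Z %| (h x - h y)%R)%Z.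
  by rewrite -(subrKA (h z)) rpredD // -opprB rpredN.
by rewrite dvd_split_level // ltnn.
Qed.

Lemma mem_light h x j :
  (j \in light h x) = (q * #|ball h j.+1 x| < q.-1 * #|ball h j x|).
Proof.
rewrite mem_filter mem_iota /= add0n; apply: andb_idr => lt_j.
have : ~~ (ball h j x \subset ball h j.+1 x).
  apply/negP=> /subset_leq_card le; move: lt_j; rewrite ltnNge => /negP; apply.
  by apply: leq_mul => //; exact: leq_pred.
case/subsetPn=> y; rewrite inE => /andP[Ay yj]; rewrite inE Ay /= => yj1.
have xy : h x != h y by apply: contraNneq yj1 => ->; rewrite subrr dvdz0.
rewrite dvd_split_level // in yj.
have d0 : 0 < absz (h x - h y)%R by rewrite absz_gt0 subr_eq0.
apply: leq_ltn_trans yj _.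
apply: leq_trans (ltn_expl _ (prime_gt1 p_prime)) _.
apply: leq_trans (dvdn_leq d0 (pfactor_dvdnn _ _)) _.
apply: leq_trans (leq_bigmax x).
exact: (leq_bigmax (F := fun y => absz (h x - h y)%R) y).
Qed.

Lemma split_card h x y : h x != h y -> let j := split_level h x y in
  #|ball h j.+1 x| + #|ball h j.+1 y| <= #|ball h j x|.
Proof.
move=> xy /=; have := split_ball_disjoint xy; rewrite -leq_card_setU => /eqP <-.
by apply/subset_leq_card/subUsetP; split; [|rewrite (split_ball_eq xy)]; apply: ballS.
Qed.

(** Two disjoint subclasses cannot both contain more than half of a class. *)
Lemma split_light h x y : 2 < q -> x \in A -> h x != h y ->
  (split_level h x y \in light h x) || (split_level h x y \in light h y).
Proof.
move=> q2 Ax xy; rewrite !mem_light -(split_ball_eq xy).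
case: ltnP => //= le1; rewrite ltnNge; apply/negP=> le2.
have sum_le := split_card xy.
have := ball_gt0 h (split_level h x y) Ax; nia.
Qed.

(** If the class of [y] is almost everything, the class of [x] has at most a
    proportion [1/q]. *)
Lemma split_heavy h x y : 0 < q -> x \in A -> h x != h y ->
  split_level h x y \notin light h y ->
  q * #|ball h (split_level h x y).+1 x| <= #|ball h (split_level h x y) x|.
Proof.
move=> q0 Ax xy; rewrite mem_light -leqNgt -(split_ball_eq xy) => le2.
have sum_le := split_card xy.
nia.
Qed.

(** Each light level multiplies the size of the class by less than
    [(q - 1) / q], and the class of [x] never becomes empty. *)
Lemma light_expn h x : x \in A ->
  q ^ size (light h x) <= q.-1 ^ size (light h x) * #|A|.
Proof.
move=> Ax.
set lt_ball := fun j => q * #|ball h j.+1 x| < q.-1 * #|ball h j x|.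
suff H n : q ^ count lt_ball (iota 0 n) * #|ball h n x|
           <= q.-1 ^ count lt_ball (iota 0 n) * #|A|.
  rewrite /light size_filter; apply: leq_trans (H _).
  by rewrite leq_pmulr // ball_gt0.
elim: n => [|n IH]; first by rewrite /= !mul1n ball0.
rewrite -addn1 iotaD /= count_cat /= add0n addn0 addn1.
have le := subset_leq_card (ballS h x (leqnSn n)).
case lt: (lt_ball n) => /=; last by rewrite addn0; apply: leq_trans IH; rewrite leq_mul2l le orbT.
rewrite addn1 !expnS.
set c := count _ _ in IH *.
rewrite (mulnC q) -mulnA; apply: leq_trans (_ : q ^ c * (q.-1 * #|ball h n x|) <= _).
  by rewrite leq_mul2l (ltnW lt) orbT.
by rewrite mulnCA -mulnA leq_mul2l IH orbT.
Qed.

(** [q] light levels at least halve the class, as [(1 - 1/q) ^ q <= 1/2]. *)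
Lemma light_size h x m : 1 < q -> x \in A -> #|A| < 2 ^ m ->
  size (light h x) < q * m.
Proof.
move=> q1 Ax Am; rewrite ltnNge; apply/negP=> le_s.
have bern r n : (r + n) * r ^ n <= r * r.+1 ^ n.
  elim: n => [|n IH]; first by rewrite addn0 !expn0 !muln1.
  rewrite !expnS; have := leq_mul (leqnn r.+1) IH; nia.
have q_half : 2 * q.-1 ^ q <= q ^ q.
  case: q q1 => [|[|r]] // _; have := bern r.+1 r.+2; rewrite /= => H.
  suff: r.+1 * (2 * r.+1 ^ r.+2) <= r.+1 * r.+2 ^ r.+2 by rewrite leq_pmul2l.
  by apply: leq_trans H; rewrite mulnA leq_mul2r; apply/orP; right; lia.
have := light_expn h Ax; move: (size _) le_s => s le_s; apply/negP; rewrite -ltnNge.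
have q'0 : 0 < q.-1 by lia.
apply: (@leq_trans (q.-1 ^ s * 2 ^ m)); first by rewrite ltn_mul2l expn_gt0 q'0.
rewrite -(subnKC le_s) !expnD mulnAC; apply: leq_mul; last first.
  by case: (s - q * m) => [|k]; rewrite ?expn0 // leq_exp2r // leq_pred.
by rewrite mulnC !expnM -expnMn; case: (m) => [|k]; rewrite ?expn0 // leq_exp2r.
Qed.

(** Below the valuation of [c] all multiples of [c] are congruent, and above
    it the tree of [c * h] is that of [h]. *)
Lemma light_scale h x (c : int) : c != 0%R ->
  {subset light (fun z => (c * h z)%R) x <= [seq logn p (absz c) + j | j <- light h x]}.
Proof.
move=> c0 u; set h1 := fun z => _; set e := logn p (absz c).
have c0' : 0 < absz c by rewrite absz_gt0.
have below j y : j <= e -> ball h1 j y = A.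
  move=> je; apply/setP=> z; rewrite !inE; case: (z \in A) => //=.
  rewrite /h1 -mulrBr dvdzE abszM /= dvdn_mulr // pfactor_dvdn //.
have above j y : ball h1 (e + j) y = ball h j y.
  apply/setP=> z; rewrite !inE; congr (_ && _).
  rewrite /h1 -mulrBr !dvdzE abszM /=.
  have [->|d0] := eqVneq (h y - h z)%R 0%R; first by rewrite muln0 !dvdn0.
  by rewrite !pfactor_dvdn ?muln_gt0 ?absz_gt0 ?c0 ?d0 // lognM ?absz_gt0 // leq_add2l.
rewrite mem_light; case: (ltnP u e) => [ue|eu].
  by rewrite !below ?(ltnW ue) // ltn_mul2r (ltnNge q) leq_pred andbF.
move: eu => /subnKC <-; rewrite -addnS !above => lt.
by apply: map_f; rewrite mem_light.
Qed.

Section Fibers.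
Hypothesis q2 : 2 < q.
Variables (h1 h2 : T -> int) (s : int).
Implicit Types (r : T * T) (R : {set T * T}).

(** [R] consists of representations of the single number [s]. *)
Definition separated R :=
  [/\ forall r, r \in R -> r.1 \in A /\ r.2 \in A,
      forall r, r \in R -> (h1 r.1 + h2 r.2)%R = s,
      {in R &, injective (fun r => h1 r.1)}
    & forall r, r \in R -> ~~ has (mem (light h2 r.2)) (light h1 r.1)].

(** Split [R] at the first level [j] where two of its pairs separate.  Two pairs
    that separate there are of opposite types, (light, heavy) and (heavy,
    light), so there are only two classes modulo [p ^ j.+1], and in each the
    product of the sizes of the two balls has dropped by a factor [q]. *)
Lemma separated_card_rec d R J : separated R ->
  (forall r r', r \in R -> r' \in R -> ((p ^ J)%N%:Z %| (h1 r.1 - h1 r'.1)%R)%Z) ->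
  (forall r, r \in R -> #|ball h1 J r.1| * #|ball h2 J r.2| < q ^ d) ->
  #|R| <= 2 ^ d.
Proof.
elim: d R J => [|d IH] R J sepR congR smallR.
  rewrite expn0; case: (set_0Vmem R) => [->|[r rR]]; first by rewrite cards0.
  have := smallR r rR; case: sepR => /(_ r rR)[A1 A2] _ _ _.
  by rewrite expn0 ltnS leqNgt muln_gt0 !ball_gt0.
case: sepR => RA Rs Rinj Rdis.
have split2 r r' : r \in R -> r' \in R -> split_level h2 r.2 r'.2 = split_level h1 r.1 r'.1.
  move=> rR r'R; rewrite /split_level; have := Rs r rR; rewrite -(Rs r' r'R) => E.
  have -> : (h2 r.2 - h2 r'.2)%R = (- (h1 r.1 - h1 r'.1))%R.
    by apply/eqP; rewrite opprB subr_eq addrAC -E [X in _ == X]addrAC subrr add0r.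
  by rewrite abszN.
have neq1 r r' : r \in R -> r' \in R -> r != r' -> h1 r.1 != h1 r'.1.
  by move=> rR r'R; apply: contraNneq => /Rinj->.
have neq2 r r' : r \in R -> r' \in R -> r != r' -> h2 r.2 != h2 r'.2.
  move=> rR r'R rr'; apply: contraNneq (neq1 _ _ rR r'R rr') => E.
  by have := Rs r rR; rewrite -(Rs r' r'R) E => /addIr ->.
(* Of two pairs that separate, exactly one is light in the first tree; each
   pair is light in one of the trees, where it loses the factor [q]. *)
have key r r' : r \in R -> r' \in R -> r != r' -> let j := split_level h1 r.1 r'.1 in
    ((j \in light h1 r.1) = (j \notin light h1 r'.1)) /\
    q * (#|ball h1 j.+1 r.1| * #|ball h2 j.+1 r.2|) <= #|ball h1 j r.1| * #|ball h2 j r.2|.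
  move=> rR r'R rr' j; have [A1 A2] := RA r rR; have [A1' A2'] := RA r' r'R.
  have n1 := neq1 _ _ rR r'R rr'; have n2 := neq2 _ _ rR r'R rr'.
  have := split_light q2 A1 n1; have := split_light q2 A2 n2.
  rewrite split2 // -/j => l2 l1.
  have d1 : j \in light h1 r.1 -> j \notin light h2 r.2.
    by move=> ?; apply: contra (Rdis r rR) => ?; apply/hasP; exists j.
  have d1' : j \in light h1 r'.1 -> j \notin light h2 r'.2.
    by move=> ?; apply: contra (Rdis r' r'R) => ?; apply/hasP; exists j.
  have le1 := subset_leq_card (ballS h1 r.1 (leqnSn j)).
  have le2 := subset_leq_card (ballS h2 r.2 (leqnSn j)).
  have q0 : 0 < q := ltnW (ltnW q2).
  have hv1 := split_heavy q0 A1 n1; have hv2 := split_heavy q0 A2 n2.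
  rewrite split2 // -/j in hv2; rewrite -/j in hv1.
  case L: (j \in light h1 r.1) l1 d1 => /= l1 d1.
    have d2 : j \in light h2 r'.2 by move: l2; rewrite (negPf (d1 isT)).
    have nl : j \notin light h1 r'.1 by apply: contraTN d2 => /d1'.
    by rewrite nl; split => //; rewrite mulnA leq_mul // hv1.
  rewrite l1; split => //.
  by rewrite mulnCA leq_mul // hv2 // d1'.
case: (leqP #|R| 1) => [le1|]; first by apply: leq_trans le1 _; rewrite expn_gt0.
case/card_gt1P=> r0 [r0' [r0R r0'R r00']].
pose P (x : (T * T) * (T * T)) := [&& x.1 \in R, x.2 \in R & x.1 != x.2].
have P0 : P (r0, r0') by rewrite /P r0R r0'R.
case: (arg_minnP (fun x : (T * T) * (T * T) => split_level h1 x.1.1 x.2.1) P0) => -[r r'].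
case/and3P=> /= rR r'R rr' minr.
set j := split_level h1 r.1 r'.1 in minr.
have congj s1 s2 : s1 \in R -> s2 \in R -> ((p ^ j)%N%:Z %| (h1 s1.1 - h1 s2.1)%R)%Z.
  move=> s1R s2R; have [->|s12] := eqVneq s1 s2; first by rewrite subrr dvdz0.
  by rewrite dvd_split_level ?neq1 //; apply: (minr (s1, s2)); rewrite /P s1R s2R s12.
have Jj : J <= j by rewrite -dvd_split_level ?neq1 // congR.
have smallj s1 s2 : s1 \in R -> s2 \in R -> ~~ ((p ^ j.+1)%N%:Z %| (h1 s1.1 - h1 s2.1)%R)%Z ->
    #|ball h1 j.+1 s1.1| * #|ball h2 j.+1 s1.2| < q ^ d /\
    (j \in light h1 s1.1) = (j \notin light h1 s2.1).
  move=> s1R s2R nd.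
  have s12 : s1 != s2 by apply: contraNneq nd => ->; rewrite subrr dvdz0.
  have js : split_level h1 s1.1 s2.1 = j.
    apply/eqP; rewrite eqn_leq -dvd_split_level ?neq1 // congj // andbT.
    by rewrite leqNgt -dvd_split_level ?neq1.
  have [] := key s1 s2 s1R s2R s12; rewrite js => -> le; split => //.
  have q0 : 0 < q := ltnW (ltnW q2).
  rewrite -(ltn_pmul2l q0) -expnS; apply: leq_ltn_trans le _.
  apply: leq_ltn_trans (smallR s1 s1R).
  by apply: leq_mul; apply: subset_leq_card; apply: ballS.
(* All pairs outside [R1] are of the type opposite to that of [r]. *)
pose R1 := [set s1 in R | ((p ^ j.+1)%N%:Z %| (h1 r.1 - h1 s1.1)%R)%Z].
pose R2 := R :\: R1.
have sepS R' : R' \subset R -> separated R'.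
  move/subsetP=> sub; split=> [r1 /sub/RA|r1 /sub/Rs|r1 r2 /sub r1R /sub r2R|r1 /sub/Rdis] //.
  exact: Rinj.
have R1R : R1 \subset R by apply/subsetP=> s1; rewrite inE => /andP[].
have R2R : R2 \subset R by apply: subsetDl.
have dB a b c : ((p ^ j.+1)%N%:Z %| (h1 a - h1 b)%R)%Z -> ((p ^ j.+1)%N%:Z %| (h1 a - h1 c)%R)%Z ->
    ((p ^ j.+1)%N%:Z %| (h1 b - h1 c)%R)%Z.
  move=> ab ac; have -> : (h1 b - h1 c = (h1 a - h1 c) - (h1 a - h1 b))%R by rewrite opprB [RHS]addrC subrKA.
  by rewrite rpredB.
have nrr' : ~~ ((p ^ j.+1)%N%:Z %| (h1 r.1 - h1 r'.1)%R)%Z by rewrite dvd_split_level ?neq1 // ltnn.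
have c1 : #|R1| <= 2 ^ d.
  apply: (IH R1 j.+1); first exact: sepS.
    by move=> s1 s2; rewrite !inE => /andP[_ d1] /andP[_ d2]; apply: dB d1 d2.
  move=> s1; rewrite inE => /andP[s1R d1].
  apply: (proj1 (smallj s1 r' s1R r'R _)); apply: contra nrr' => d2.
  have -> : (h1 r.1 - h1 r'.1 = (h1 r.1 - h1 s1.1) + (h1 s1.1 - h1 r'.1))%R by rewrite subrKA.
  by rewrite rpredD.
have R2E s1 : s1 \in R2 -> s1 \in R /\ ~~ ((p ^ j.+1)%N%:Z %| (h1 s1.1 - h1 r.1)%R)%Z.
  rewrite !inE => /andP[n1 s1R]; split => //; move: n1; rewrite s1R /=.
  by apply: contra => d1; rewrite -opprB rpredN.
have c2 : #|R2| <= 2 ^ d.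
  apply: (IH R2 j.+1); first exact: sepS.
    move=> s1 s2 /R2E[s1R n1] /R2E[s2R n2]; apply/negPn/negP => n12.
    have [_ E1] := smallj _ _ s1R rR n1; have [_ E2] := smallj _ _ s2R rR n2.
    by have [_] := smallj _ _ s1R s2R n12; rewrite E1 E2; case: (_ \in _).
  by move=> s1 /R2E[s1R n1]; case: (smallj s1 r s1R rR n1).
rewrite -(cardsID R1 R) -/R2 (setIidPr R1R) expnS mul2n -addnn.
exact: leq_add.
Qed.

Lemma separated_card d R : separated R -> #|A| ^ 2 < q ^ d -> #|R| <= 2 ^ d.
Proof.
move=> sepR Ad; apply: (@separated_card_rec d R 0) => //.
by move=> r rR; rewrite !ball0.
Qed.

End Fibers.

End Balls.

(** * Combinatorial selection *)

Lemma pigeonhole (U : finType) (G : {set U}) (c : U -> nat) m :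
  (forall e, e \in G -> c e < m) ->
  exists i, #|G| <= m * #|[set e in G | c e == i]|.
Proof.
case: m => [|m] cG.
  exists 0; rewrite mul0n leqn0 cards_eq0; apply/eqP/setP=> e; rewrite !inE.
  by apply/negP=> /cG.
pose g (i : 'I_m.+1) := #|[set e in G | c e == i]|.
case: (arg_maxnP g (isT : xpredT (ord0 : 'I_m.+1))) => i _ maxi; exists (i : nat).
have -> : #|G| = \sum_(j < m.+1) g j.
  rewrite -sum1_card (partition_big (fun e => inord (c e) : 'I_m.+1) xpredT) //=.
  apply: eq_bigr => j _; rewrite /g -sum1_card; apply: eq_bigl => e; rewrite inE.
  by case eG: (e \in G) => //=; rewrite -val_eqE /= inordK // cG.
apply: (@leq_trans (\sum_(j < m.+1) g i)); last by rewrite sum_nat_const card_ord.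
by apply: leq_sum => j _; exact: maxi.
Qed.

(** Greedy colouring: a new vertex gets the colour that adds the least weight
    of monochromatic edges, which is at most the average over the colours. *)
Lemma colouring (w : nat -> nat -> nat) m n : 0 < m -> (forall u, w u u = 0) ->
  exists2 c : nat -> nat, forall v, c v < m &
    m * (\sum_(u < n) \sum_(v < n) w u v * (c u == c v)) <= \sum_(u < n) \sum_(v < n) w u v.
Proof.
move=> m0 w0; elim: n => [|n [c cm IH]].
  by exists (fun=> 0) => //; rewrite !big_ord0 muln0.
pose g i := \sum_(v < n) (w n v + w v n) * (c v == i).
have [i im gi] : exists2 i, i < m & m * g i <= \sum_(v < n) (w n v + w v n).
  case: m m0 {IH} cm => // m _ cm.
  case: (arg_minnP (fun i : 'I_m.+1 => g i) (isT : xpredT (ord0 : 'I_m.+1))) => i _ mini.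
  exists i => //.
  apply: (@leq_trans (\sum_(j < m.+1) g j)).
    apply: (@leq_trans (\sum_(j < m.+1) g i)); first by rewrite sum_nat_const card_ord.
    by apply: leq_sum => j _; exact: mini.
  rewrite /g exchange_big /=; apply: leq_sum => v _; rewrite -big_distrr /=.
  rewrite (bigD1 (Ordinal (cm v))) //= eqxx big1 ?addn0 ?muln1 // => j.
  by rewrite -val_eqE /= eq_sym => /negPf->.
pose c' v := if v == n then i else c v.
exists c' => [v|]; first by rewrite /c'; case: eqP.
have c'n : c' n = i by rewrite /c' eqxx.
have c'E (v : 'I_n) : c' v = c v by rewrite /c' ltn_eqF.
have recl (F : nat -> nat -> nat) : F n n = 0 ->
    \sum_(u < n.+1) \sum_(v < n.+1) F u v =
    \sum_(u < n) \sum_(v < n) F u v + \sum_(v < n) (F n v + F v n).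
  move=> F0; rewrite big_ord_recr /= big_ord_recr /= F0 addn0.
  under eq_bigr => u _ do rewrite big_ord_recr /=.
  by rewrite !big_split /= addnAC addnA.
rewrite (recl w) // (recl (fun u v => w u v * (c' u == c' v))) ?w0 //.
rewrite mulnDr; apply: leq_add.
  apply: leq_trans IH; rewrite leq_mul2l; apply/orP; right.
  by apply: leq_sum => u _; apply: leq_sum => v _; rewrite !c'E.
apply: leq_trans gi; rewrite leq_mul2l; apply/orP; right; apply: leq_sum => v _.
by rewrite c'n c'E mulnDl eq_sym.
Qed.

(** With [2 * f] colours, at least half of the [e] in [E] have no element of
    [F e] coloured like [t e]; [B] is a frequent colour of [t e] among them. *)
Lemma independent_selection (U : finType) (E : {set U}) (t : U -> nat) (F : U -> seq nat) f :
  0 < f -> (forall e, e \in E -> size (F e) <= f /\ t e \notin F e) ->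
  exists B : pred nat, #|E| <= 4 * f * #|[set e in E | B (t e) && ~~ has B (F e)]|.
Proof.
move=> f0 EF.
pose n := (\max_e maxn (t e) (\max_(v <- F e) v)).+1.
have tn e : t e < n by rewrite ltnS; apply: leq_trans (leq_bigmax e); rewrite leq_maxl.
have Fn e v : v \in F e -> v < n.
  move=> vF; rewrite ltnS; apply: leq_trans (leq_bigmax e).
  by apply: leq_trans (leq_maxr _ _); apply: leq_bigmax_seq.
pose w u v := \sum_(e in E) (t e == u) * (v \in F e).
have w0 u : w u u = 0.
  rewrite /w big1 // => e eE; case: eqP => // <-.
  by have [_ /negPf->] := EF e eE; rewrite muln0.
have m0 : 0 < 2 * f by rewrite muln_gt0.
have [c cm conf] := colouring n m0 w0.
have exch (g : nat -> nat -> nat) : \sum_(u < n) \sum_(v < n) w u v * g u v =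
    \sum_(e in E) \sum_(v < n) (nat_of_bool ((v : nat) \in F e)) * g (t e) v.
  rewrite (eq_bigr (fun u : 'I_n => \sum_(e in E) \sum_(v < n) (t e == u) * (((v:nat) \in F e) * g u v))).
    rewrite exchange_big /=; apply: eq_bigr => e _.
    rewrite (bigD1 (Ordinal (tn e))) //= eqxx [X in _ + X]big1 ?addn0.
      by apply: eq_bigr => v _; rewrite mul1n.
    by move=> u; rewrite -val_eqE /= eq_sym => /negPf->; rewrite big1.
  move=> u _; rewrite exchange_big /=; apply: eq_bigr => v _.
  by rewrite /w big_distrl /=; apply: eq_bigr => e _; rewrite mulnA.
have tot : \sum_(u < n) \sum_(v < n) w u v <= f * #|E|.
  under eq_bigr => u _ do under eq_bigr => v _ do rewrite -[w u v]muln1.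
  rewrite (exch (fun _ _ => 1)) mulnC -sum_nat_const; apply: leq_sum => e eE.
  apply: leq_trans (proj1 (EF e eE)).
  under eq_bigr => v _ do rewrite muln1.
  rewrite -(big_mkord xpredT (fun v => nat_of_bool (v \in F e))) /=.
  rewrite -big_mkcond /= sum1_count /index_iota subn0 -size_filter.
  by apply: uniq_leq_size => [|v]; rewrite ?filter_uniq ?iota_uniq // mem_filter => /andP[].
pose bad := [set e in E | has (fun v => c v == c (t e)) (F e)].
have bad_small : 2 * #|bad| <= #|E|.
  rewrite -(leq_pmul2l f0) mulnA (mulnC f); apply: leq_trans tot.
  apply: leq_trans conf; rewrite leq_mul2l; apply/orP; right.
  rewrite (exch (fun u v => nat_of_bool (c u == c v))) -sum1_card big_mkcond [leqRHS]big_mkcond /=.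
  apply: leq_sum => e _; rewrite inE; case: (e \in E) => //=.
  case: hasP => // -[v vF cv]; rewrite (bigD1 (Ordinal (Fn e v vF))) //= vF eq_sym cv.
  by rewrite mul1n leq_addr.
have [i Hi] := @pigeonhole U (E :\: bad) (fun e => c (t e)) (2 * f) (fun e _ => cm (t e)).
exists (fun v => c v == i).
have sizes : #|E| <= 2 * #|E :\: bad|.
  have := cardsID bad E; have /setIidPr -> : bad \subset E by apply/subsetP=> e; rewrite inE => /andP[].
  lia.
apply: leq_trans sizes _; rewrite -(mulnA 2 2) -mulnA mulnA.
apply: leq_trans (_ : 2 * (2 * f * #|[set e in E :\: bad | c (t e) == i]|) <= _).
  by rewrite leq_mul2l Hi.
rewrite !mulnA leq_mul2l; apply/orP; right; apply: subset_leq_card; apply/subsetP=> e.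
rewrite !inE => /andP[/andP[nb eE] /eqP ci]; rewrite eE ci eqxx /=.
by move: nb; rewrite eE /= ci.
Qed.

(** * Sums that determine valuations *)

Lemma logn_add_lt p (m n : int) : prime p -> m != 0%R -> n != 0%R ->
  logn p (absz m) < logn p (absz n) -> logn p (absz (m + n)%R) = logn p (absz m).
Proof.
move=> pp m0 n0 lt.
have dvdE j d : d != 0%R -> ((p ^ j)%N%:Z %| d)%Z = (j <= logn p (absz d)).
  by move=> d0; rewrite dvdzE /= pfactor_dvdn // absz_gt0.
have nd : ~~ ((p ^ (logn p (absz m)).+1)%N%:Z %| (m + n)%R)%Z.
  by rewrite rpredDr ?dvdE // ltnn.
have mn0 : (m + n)%R != 0%R by apply: contraNneq nd => ->; rewrite dvdz0.
apply/eqP; rewrite eqn_leq leqNgt -dvdE // nd /= -dvdE //.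
by apply: rpredD; rewrite dvdE // ltnW.
Qed.

(** The sign [sg] allows sums and differences to be treated at once. *)
Section Separation.
Variables (T : finType) (q f : nat) (A : {set T}) (val : T -> nat) (sg : int).
Hypotheses (q2 : 2 < q) (f0 : 0 < f) (val0 : forall x, 0 < val x) (sg1 : absz sg = 1).
Let hval x : int := val x.

(** The common valuation of the sums is that of [a r].  If [b r] and [b r'] had
    different valuations, the smaller of these, which lies in [B], would be the
    valuation of [val (a r) - val (a r')] and hence a light level of [a r] or
    [a r'], whereas [B] contains no such level. *)
Lemma sum_fixes_valuation p (E : {set T * T}) (a b : T * T -> T) (c1 c2 : int) :
  prime p -> absz c1 = 1 -> absz c2 = 1 ->
  (forall r, r \in E -> [/\ a r \in A, size (light p q A hval (a r)) <= f,
     logn p (val (a r)) < logn p (val (b r)) &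
     logn p (val (b r)) \notin light p q A hval (a r)]) ->
  exists2 E' : {set T * T}, E' \subset E /\ #|E| <= 4 * f * #|E'| &
    forall r r', r \in E' -> r' \in E' ->
      (c1 * hval (a r) + c2 * hval (b r) = c1 * hval (a r') + c2 * hval (b r'))%R ->
      logn p (val (a r)) = logn p (val (a r')) /\ logn p (val (b r)) = logn p (val (b r')).
Proof.
move=> pp c11 c21 EP.
have [||B EB] := @independent_selection _ E (fun r => logn p (val (b r)))
  (fun r => light p q A hval (a r)) f => //.
  by move=> r /EP[].
eexists; first split; [|exact: EB|].
  by apply/subsetP=> r; rewrite inE => /andP[].
move=> r r'; rewrite !inE => /and3P[rE Bb nBa] /and3P[r'E Bb' nBa'] sumE.
have hv0 x : hval x != 0%R by rewrite /hval -lt0n.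
have c10 : c1 != 0%R by rewrite -absz_eq0 c11.
have c20 : c2 != 0%R by rewrite -absz_eq0 c21.
have [aA _ ltr nr] := EP r rE; have [aA' _ ltr' nr'] := EP r' r'E.
have vsum s : s \in E -> logn p (absz (c1 * hval (a s) + c2 * hval (b s))%R) = logn p (val (a s)).
  move=> sE; have [_ _ lt _] := EP s sE.
  by rewrite logn_add_lt ?mulf_neq0 ?abszM ?c11 ?c21 ?mul1n.
have ta : logn p (val (a r)) = logn p (val (a r')) by rewrite -!vsum // sumE.
split=> //; apply/eqP; apply/negPn/negP => tb.
have dE : absz (hval (a r) - hval (a r'))%R = absz (hval (b r) - hval (b r'))%R.
  have : (c1 * (hval (a r) - hval (a r')) = - c2 * (hval (b r) - hval (b r')))%R.
    rewrite mulNr !mulrBr opprB; apply/eqP.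
    by rewrite -subr_eq0 opprB addrACA -opprD sumE subrr.
  by move/(congr1 absz); rewrite !abszM abszN c11 c21 !mul1n.
have va : hval (a r) != hval (a r').
  apply: contraNneq tb => E0; move: dE; rewrite E0 subrr => /esym/eqP.
  by rewrite absz_eq0 subr_eq0 => /eqP[->].
have sB : B (split_level p hval (a r) (a r')).
  rewrite /split_level dE; case: (ltngtP (logn p (val (b r))) (logn p (val (b r')))) tb => // lt _.
    by rewrite logn_add_lt ?oppr_eq0 ?abszN.
  by rewrite addrC logn_add_lt ?oppr_eq0 ?abszN.
case/orP: (split_light pp q2 aA va) => l.
  by case/negP: nBa; apply/hasP; exists (split_level p hval (a r) (a r')).
by case/negP: nBa'; apply/hasP; exists (split_level p hval (a r) (a r')).
Qed.

Definition pairsum (r : T * T) : int := (hval r.1 + sg * hval r.2)%R.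

Lemma sum_fixes_valuations (ps : seq nat) (E : {set T * T}) :
  all prime ps ->
  (forall r, r \in E -> r.1 \in A /\ r.2 \in A) ->
  (forall p x, p \in ps -> x \in A -> size (light p q A hval x) <= f) ->
  (forall p r, p \in ps -> r \in E -> [/\ logn p (val r.1) != logn p (val r.2),
     logn p (val r.2) \notin light p q A hval r.1 &
     logn p (val r.1) \notin light p q A hval r.2]) ->
  exists2 E' : {set T * T}, E' \subset E /\ #|E| <= (8 * f) ^ size ps * #|E'| &
    forall p r r', p \in ps -> r \in E' -> r' \in E' -> pairsum r = pairsum r' ->
      logn p (val r.1) = logn p (val r'.1) /\ logn p (val r.2) = logn p (val r'.2).
Proof.
elim: ps E => [|p ps IH] E /=.
  by move=> _ EA _ _; exists E; rewrite // subxx expn0 mul1n.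
case/andP=> pp pps EA szA EP.
have [E1 [E1E leE1] E1P] : exists2 E1 : {set T * T}, E1 \subset E /\ #|E| <= 8 * f * #|E1| &
    forall r r', r \in E1 -> r' \in E1 -> pairsum r = pairsum r' ->
      logn p (val r.1) = logn p (val r'.1) /\ logn p (val r.2) = logn p (val r'.2).
  pose L := [set r in E | logn p (val r.1) < logn p (val r.2)].
  have LE : L \subset E by apply/subsetP=> r; rewrite inE => /andP[].
  have := cardsID L E; rewrite (setIidPr LE).
  case: (leqP #|E :\: L| #|L|) => le cardE.
    have [|||E1 [E1L leE1] E1P] := @sum_fixes_valuation p L fst snd 1%R sg pp => //.
      move=> r; rewrite inE => /andP[rE lt]; have [r1A r2A] := EA r rE.
      by have [_ n1 n2] := EP p r (mem_head _ _) rE; split=> //; apply: szA; rewrite ?mem_head.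
    exists E1; first by split; [exact: subset_trans E1L LE | nia].
    by move=> r r' rE rE' s; apply: (E1P r r' rE rE'); rewrite !mul1r.
  have [|||E1 [E1L leE1] E1P] := @sum_fixes_valuation p (E :\: L) snd fst sg 1%R pp => //.
    move=> r; rewrite !inE => /andP[nl rE]; have [r1A r2A] := EA r rE.
    have [n0 n1 n2] := EP p r (mem_head _ _) rE; split=> //; first by apply: szA; rewrite ?mem_head.
    by move: nl; rewrite rE /= -leqNgt leq_eqVlt eq_sym (negPf n0).
  exists E1; first by split; [exact: subset_trans E1L (subsetDl _ _) | nia].
  move=> r r' rE rE' s; have [] := E1P r r' rE rE' => //.
  by rewrite !mul1r addrC [RHS]addrC.
have [|||E2 [E2E1 leE2] E2P] := IH E1 pps.
- by move=> r /(subsetP E1E)/EA.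
- by move=> p' x p'ps; apply: szA; rewrite inE p'ps orbT.
- by move=> p' r p'ps /(subsetP E1E); apply: EP; rewrite inE p'ps orbT.
exists E2.
  split; first exact: subset_trans E2E1 E1E.
  apply: leq_trans leE1 _; by rewrite expnS -(mulnA (8 * f)) leq_mul2l leE2 orbT.
move=> p' r r'; rewrite inE => /orP[/eqP->|p'ps] rE rE'; last exact: E2P.
by apply: E1P; exact: (subsetP E2E1).
Qed.

End Separation.

(** * Large sumset, or a valuation determined by the remaining part *)

Lemma card_le_fibers (U : finType) (K : choiceType) (E : {set U}) (phi : U -> K) (D : {fset K}) m :
  (forall e, e \in E -> phi e \in D) ->
  (forall s, #|[set e in E | phi e == s]| <= m) ->
  #|E| <= #|` D| * m.
Proof.
move=> ED fib.
have [|i] := @pigeonhole _ E (fun e => index (phi e) D) #|` D|.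
  by move=> e /ED; rewrite index_mem.
move/leq_trans; apply; rewrite leq_mul2l; apply/orP; right.
have [->|[e0]] := set_0Vmem [set e in E | index (phi e) D == i]; first by rewrite cards0.
rewrite inE => /andP[e0E /eqP e0i]; apply: leq_trans (fib (phi e0)).
apply: subset_leq_card; apply/subsetP=> e; rewrite !inE => /andP[eE /eqP ei]; rewrite eE /=.
by rewrite -(nth_index (phi e0) (ED e eE)) ei -e0i nth_index ?ED.
Qed.

(** Pairs with a common level are rare if no level is popular. *)
Lemma card_conflicts (T : finType) (A : {set T}) (V W : T -> seq nat) w m :
  (forall x, x \in A -> size (W x) <= w) ->
  (forall j, #|[set x in A | j \in V x]| <= m) ->
  #|[set r : T * T | [&& r.1 \in A, r.2 \in A & has (mem (V r.2)) (W r.1)]]| <= #|A| * (w * m).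
Proof.
move=> szW Vm.
rewrite -sum1_card (eq_bigl (fun r : T * T => (r.1 \in A) && ((r.2 \in A) && has (mem (V r.2)) (W r.1)))); last first.
  by move=> r; rewrite inE.
rewrite -(pair_big_dep (mem A) (fun x y => (y \in A) && has (mem (V y)) (W x)) (fun _ _ => 1)) /=.
rewrite -sum_nat_const; apply: leq_sum => x xA; apply: leq_trans (leq_mul (szW x xA) (leqnn m)).
rewrite sum1dep_card; elim: (W x) => [|j s IH] /=.
  by rewrite leqn0 cards_eq0; apply/eqP/setP=> y; rewrite !inE andbF.
apply: leq_trans (leq_add (Vm j) IH); rewrite -cardsUI; apply: leq_trans (leq_addr _ _).
by apply: subset_leq_card; apply/subsetP=> y; rewrite !inE; case: (y \in A).
Qed.

Lemma ball_congr (T : finType) p (A : {set T}) (h : T -> int) j x y :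
  h x = h y -> ball p A h j x = ball p A h j y.
Proof. by move=> hxy; apply/setP=> z; rewrite !inE hxy. Qed.

Lemma light_congr (T : finType) p q (A : {set T}) (h : T -> int) x y :
  h x = h y -> light p q A h x = light p q A h y.
Proof. by move=> hxy; apply: eq_filter => j; rewrite !(ball_congr p A _ hxy). Qed.

Definition primeset (ps : seq nat) : nat_pred := [pred p | p \in ps].

Section Stage.
Variables (T : finType) (q m d : nat) (val : T -> nat) (sg : int).
Hypotheses (q2 : 2 < q) (m0 : 0 < m) (val0 : forall x, 0 < val x) (val_inj : injective val).
Hypothesis sg1 : absz sg = 1.
Let f := q * m.

Definition active ps x := (val x)`_(primeset ps).
Definition passive ps x := (val x)`_(primeset ps)^'.

Let hval x : int := val x.
Let hpas ps x : int := passive ps x.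

(** The light levels of [x] among the multiples [active x * passive y], and the
    valuation of [x], which is included so that pairs without common marked
    level have different valuations. *)
Definition marked A ps p x : seq nat :=
  logn p (val x) :: [seq logn p (val x) + j | j <- light p q A (hpas ps) x].

Lemma active_passive ps x : active ps x * passive ps x = val x.
Proof. exact: partnC. Qed.

Lemma active_eq ps x y : (forall p, p \in ps -> logn p (val x) = logn p (val y)) ->
  active ps x = active ps y.
Proof. by move=> E; apply: eq_partn_from_log. Qed.

Lemma logn_active ps p x : p \in ps -> logn p (active ps x) = logn p (val x).
Proof. by move=> pps; rewrite -logn_part partn_part ?logn_part // => r; rewrite inE => /eqP->. Qed.

Variables (A : {set T}) (ps : seq nat).
Hypotheses (Am : #|A| < 2 ^ m) (Ad : #|A| ^ 2 < q ^ d) (psP : all prime ps).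

Let size_light p h x : p \in ps -> x \in A -> size (light p q A h x) <= f.
Proof.
by move=> pps xA; apply/ltnW/light_size => //; [exact: (allP psP) | exact: ltnW].
Qed.

Let size_marked p x : p \in ps -> x \in A -> size (marked A ps p x) <= f.+1.
Proof. by move=> pps xA; rewrite /= size_map ltnS size_light. Qed.

(** If [j] is marked for [x], then [passive x] leaves at most [f + 1]
    possibilities for the valuation of [x]: it is [j], or [j - u] with [u] a
    light level of [passive x].  In [A'] the valuation of [x] stands at a fixed
    position of this list. *)
Lemma passive_fixes_valuation p j c : p \in ps -> #|A| <= c * #|[set x in A | j \in marked A ps p x]| ->
  exists2 A' : {set T}, A' \subset A /\ #|A| <= c * f.+1 * #|A'| &
    forall x y, x \in A' -> y \in A' -> passive ps x = passive ps y -> logn p (val x) = logn p (val y).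
Proof.
move=> pps; set A0 := [set x in A | _] => leA.
pose l x := j :: [seq j - u | u <- light p q A (hpas ps) x].
have tl x : x \in A0 -> logn p (val x) \in l x.
  rewrite !inE => /andP[xA /orP[/eqP->|/mapP[u ul ->]]]; first by rewrite eqxx.
  by apply/orP; right; apply/mapP; exists u; rewrite ?addnK.
have A0A : A0 \subset A by apply/subsetP=> x; rewrite inE => /andP[].
have [|i Hi] := @pigeonhole _ A0 (fun x => index (logn p (val x)) (l x)) f.+1.
  move=> x xA0; apply: (@leq_trans (size (l x))); first by rewrite index_mem tl.
  by rewrite /= size_map ltnS size_light // (subsetP A0A).
exists [set x in A0 | index (logn p (val x)) (l x) == i].
  split; first by apply: subset_trans A0A; apply/subsetP=> x; rewrite inE => /andP[].
  by apply: leq_trans leA _; rewrite -mulnA leq_mul2l Hi orbT.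
move=> x y; rewrite inE => /andP[xA0 /eqP ix]; rewrite inE => /andP[yA0 /eqP iy] xy.
have lxy : l x = l y by rewrite /l (@light_congr _ p q A (hpas ps) x y) // /hpas xy.
by rewrite -(nth_index 0 (tl x xA0)) -(nth_index 0 (tl y yA0)) ix iy lxy.
Qed.

(** Two elements are in conflict at [p] if they have a common marked level, or
    if the valuation of one is a light level of the other in the tree of [A].
    Without popular level, at least half of all pairs have no conflict at any
    prime of [ps]; hence the factor [4 * size ps * f.*2.+1], as an element has
    at most [2 * f + 1] levels of either kind.  A dense part of them is such that the sum determines the
    active parts, and for given active parts the representations of a sum are
    separated for the trees of the multiples of the passive parts. *)
Lemma sumset_large (D : {fset int}) : 0 < size ps ->
  (forall x y, x \in A -> y \in A -> (hval x + sg * hval y)%R \in D) ->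
  (forall p j, p \in ps ->
     4 * size ps * f.*2.+1 * #|[set x in A | j \in marked A ps p x]| <= #|A|) ->
  #|A| ^ 2 <= 2 * (8 * f) ^ size ps * 2 ^ d * #|` D|.
Proof.
move=> ps0 AD popular.
set c := 4 * size ps * f.*2.+1 in popular.
have c0 : 0 < c by rewrite !muln_gt0 ps0.
pose bad1 p := [set r : T * T | [&& r.1 \in A, r.2 \in A &
   has (mem (marked A ps p r.2)) (marked A ps p r.1 ++ light p q A hval r.1)]].
pose swap (r : T * T) := (r.2, r.1).
have swap_inj : injective swap by case=> a b [a' b'] [-> ->].
pose bad p := bad1 p :|: swap @: bad1 p.
have bad_small p : p \in ps -> #|bad p| * (2 * size ps) <= #|A| ^ 2.
  move=> pps; set M := #|A| %/ c.
  have b1 : #|bad1 p| <= #|A| * (f.*2.+1 * M).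
    apply: (@card_conflicts T A (marked A ps p) (fun x => marked A ps p x ++ light p q A hval x)) => [x xA|j].
      have := size_marked pps xA; have := size_light hval pps xA; rewrite size_cat; lia.
    by rewrite leq_divRL // mulnC popular.
  have b2 : #|bad p| <= 2 * #|bad1 p|.
    rewrite mul2n -addnn -[X in _ <= _ + X](card_imset (mem (bad1 p)) swap_inj).
    by rewrite -cardsUI leq_addr.
  have cM : c * M <= #|A| by rewrite mulnC leq_trunc_div.
  apply: (@leq_trans (#|A| * (c * M))); last by rewrite -mulnn leq_mul2l cM orbT.
  apply: leq_trans (leq_mul b2 (leqnn _)) _.
  apply: leq_trans (leq_mul (leq_mul (leqnn 2) b1) (leqnn _)) _.
  by rewrite /c; nia.
(* The pairs without conflict. *)
pose E0 := [set r : T * T | [&& r.1 \in A, r.2 \in A & all (fun p => r \notin bad p) ps]].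
have E0_large : #|A| ^ 2 <= 2 * #|E0|.
  have H s : #|setX A A| <= #|[set r : T * T | [&& r.1 \in A, r.2 \in A & all (fun p => r \notin bad p) s]]|
      + \sum_(p <- s) #|bad p|.
    elim: s => [|p s IH].
      rewrite big_nil addn0; apply: subset_leq_card; apply/subsetP=> -[x y].
      by rewrite !inE /= andbT.
    apply: leq_trans IH _; rewrite big_cons addnA leq_add2r.
    rewrite -cardsUI; apply: leq_trans (leq_addr _ _).
    apply: subset_leq_card; apply/subsetP=> r; rewrite inE => /and3P[r1 r2 rs].
    rewrite in_setU orbC; case rb: (r \in bad p) => //=.
    by rewrite inE r1 r2 /= rb rs.
  have := H ps; rewrite cardsX mulnn -/E0 => le1.
  have le2 : (\sum_(p <- ps) #|bad p|) * (2 * size ps) <= size ps * #|A| ^ 2.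
    rewrite big_distrl /= big_seq.
    apply: (@leq_trans (\sum_(p <- ps | p \in ps) #|A| ^ 2)); first exact: leq_sum.
    by rewrite -big_seq big_const_seq count_predT iter_addn_0 mulnC.
  rewrite -(leq_pmul2r ps0); nia.
have E0P r : r \in E0 -> [/\ r.1 \in A, r.2 \in A & forall p, p \in ps -> r \notin bad p].
  by rewrite inE => /and3P[? ? /allP ?]; split.
have nbad p r : p \in ps -> r \in E0 ->
    ~~ has (mem (marked A ps p r.2)) (marked A ps p r.1 ++ light p q A hval r.1) /\
    ~~ has (mem (marked A ps p r.1)) (marked A ps p r.2 ++ light p q A hval r.2).
  move=> pps rE; have [r1 r2 /(_ p pps)] := E0P r rE.
  rewrite in_setU negb_or => /andP[n1 n2]; split.
    by apply: contra n1 => n1; rewrite inE r1 r2.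
  apply: contra n2 => n2; apply/imsetP; exists (swap r); last by case: (r).
  by rewrite inE /= r1 r2.
have [| | |p r pps rE|E' [E'E leE'] E'P] := @sum_fixes_valuations T q f A val sg q2 _ val0 sg1 ps E0 psP.
- by rewrite muln_gt0 m0; lia.
- by move=> r /E0P[].
- by move=> p x; apply: size_light.
- have [n1 n2] := nbad p r pps rE; split.
  + apply: contra n1 => /eqP E; apply/hasP; exists (logn p (val r.1)); rewrite ?mem_head //=.
    by rewrite E mem_head.
  + apply: contra n1 => E; apply/hasP; exists (logn p (val r.2)); last exact: mem_head.
    by rewrite mem_cat E orbT.
  + apply: contra n2 => E; apply/hasP; exists (logn p (val r.1)); last exact: mem_head.
    by rewrite mem_cat E orbT.
have sg0 : sg != 0%R by rewrite -absz_eq0 sg1.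
have fib s : #|[set r in E' | pairsum val sg r == s]| <= 2 ^ d.
  set R := [set r in E' | _].
  have [->|[r0 r0R]] := set_0Vmem R; first by rewrite cards0.
  have RE r : r \in R -> r \in E' /\ pairsum val sg r = s.
    by rewrite inE => /andP[? /eqP].
  (* A single prime suffices to separate the representations. *)
  have [p0 p0ps] : exists p0, p0 \in ps by case: (ps) ps0 => // p0 ps' _; exists p0; rewrite mem_head.
  pose g1 := active ps r0.1; pose g2 := active ps r0.2.
  have g12 r : r \in R -> active ps r.1 = g1 /\ active ps r.2 = g2.
    move=> rR; have [rE rs] := RE r rR; have [r0E r0s] := RE r0 r0R.
    have E p : p \in ps -> _ := fun pps => E'P p r r0 pps rE r0E (etrans rs (esym r0s)).
    by split; apply: active_eq => p /E[].
  pose h1 x : int := (Posz g1 * hpas ps x)%R.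
  pose h2 x : int := (sg * Posz g2 * hpas ps x)%R.
  have h1E r : r \in R -> h1 r.1 = hval r.1.
    by move=> /g12[E _]; rewrite /h1 -E /hval -(active_passive ps r.1) PoszM.
  have h2E r : r \in R -> h2 r.2 = (sg * hval r.2)%R.
    by move=> /g12[_ E]; rewrite /h2 -E /hval -mulrA -(active_passive ps r.2) PoszM.
  have g1_0 : Posz g1 != 0%R by rewrite -lt0n part_gt0.
  have g2_0 : (sg * Posz g2)%R != 0%R by rewrite mulf_neq0 // -lt0n part_gt0.
  apply: (@separated_card T p0 q A (allP psP p0 p0ps) q2 h1 h2 s d R _ Ad).
  split.
  - by move=> r /RE[/(subsetP E'E)/E0P[]].
  - by move=> r rR; rewrite h1E // h2E //; case: (RE r rR).
  - move=> r r' rR r'R; rewrite h1E // h1E // => -[/val_inj e1].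
    have [_ rs] := RE r rR; have [_] := RE r' r'R; rewrite -rs /pairsum e1 => /addrI/(mulfI sg0)[/val_inj e2].
    by case: r r' e1 e2 {rR r'R rs} => [? ?] [? ?] /= -> ->.
  - move=> r rR; have [rE _] := RE r rR; have [n1 _] := nbad p0 r p0ps (subsetP E'E r rE).
    have [a1 a2] := g12 r rR.
    apply: contra n1 => /hasP[j j1 j2]; apply/hasP; exists j.
      have := light_scale (allP psP p0 p0ps) g1_0 j1.
      by rewrite absz_nat -a1 logn_active // mem_cat inE => ->; rewrite orbT.
    have := light_scale (allP psP p0 p0ps) g2_0 j2.
    rewrite abszM sg1 mul1n absz_nat -a2 logn_active // => H.
    by rewrite -[mem _ _]/(j \in marked A ps p0 r.2) inE H orbT.
have leD : #|E'| <= #|` D| * 2 ^ d.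
  apply: card_le_fibers fib => r /(subsetP E'E)/E0P[r1 r2 _]; exact: AD.
apply: leq_trans E0_large _.
rewrite -!mulnA leq_mul2l /=; apply: leq_trans leE' _.
by rewrite leq_mul2l (mulnC (2 ^ d)) leD orbT.
Qed.

End Stage.

(** * Iteration over the primes *)

Lemma passive_step (T : finType) (val : T -> nat) (ps : seq nat) p x y :
  (forall x, 0 < val x) -> passive val ps x = passive val ps y ->
  logn p (val x) = logn p (val y) ->
  passive val (filter (predC1 p) ps) x = passive val (filter (predC1 p) ps) y.
Proof.
move=> val0 Eps Ep; apply: eq_partn_from_log => // r.
rewrite !inE mem_filter negb_and /= negbK => /orP[/eqP-> //|rps].
have E z : logn r (val z) = logn r (passive val ps z).
  rewrite -[RHS]logn_part partn_part ?logn_part // => s.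
  by rewrite !inE => /eqP->.
by rewrite !E Eps.
Qed.

(** If some level is popular, a prime leaves the list [ps] at the cost of a
    constant factor in the size of the set. *)
Lemma sumset_large_or_passive_inj (T : finType) (q m d k : nat) (val : T -> nat) (sg : int)
    (D : {fset int}) (ps : seq nat) (A : {set T}) :
  2 < q -> 0 < m -> (forall x, 0 < val x) -> injective val -> absz sg = 1 ->
  #|A| < 2 ^ m -> #|A| ^ 2 < q ^ d -> all prime ps -> size ps <= k ->
  (forall x y, (Posz (val x) + sg * Posz (val y))%R \in D) ->
  exists2 A' : {set T}, A' \subset A /\
      #|A| <= (4 * k * (q * m).*2.+1 * (q * m).+1) ^ size ps * #|A'| &
    #|A'| ^ 2 <= 2 * (8 * (q * m)) ^ k * 2 ^ d * #|` D| \/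
    {in A' &, injective (passive val ps)}.
Proof.
move=> q2 m0 val0 val_inj sg1 + + + + DD.
set f := q * m; set c := 4 * k * f.*2.+1 * f.+1.
have f0 : 0 < f by rewrite muln_gt0 m0; lia.
have [n] := ubnP (size ps); elim: n ps A => // n IH ps A.
rewrite ltnS => psn Am Ad psP psk.
case: (posnP (size ps)) => [/size0nil->|ps0].
  exists A; first by rewrite expn0 mul1n.
  right=> x y _ _; rewrite /passive !part_pnat_id; first exact: val_inj.
    by rewrite /pnat val0; apply/allP=> p; rewrite !inE.
  by rewrite /pnat val0; apply/allP=> p; rewrite !inE.
have k0 : 0 < k by lia.
have c0 : 0 < c by rewrite /c !muln_gt0 k0.
pose small p j := 4 * size ps * f.*2.+1 * #|[set x in A | j \in marked q val A ps p x]| <= #|A|.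
case: (boolP (all (fun p => all (small p) (flatten [seq marked q val A ps p x | x <- enum A])) ps)).
  move=> /allP all_small; exists A.
    by split=> //; rewrite leq_pmull // expn_gt0 c0.
  left; apply: leq_trans (_ : 2 * (8 * f) ^ size ps * 2 ^ d * #|` D| <= _).
    apply: (sumset_large q2 m0 val0 val_inj sg1 Am Ad psP ps0) => // p j pps.
    have /allP sm := all_small p pps.
    case jin : (j \in flatten [seq marked q val A ps p x | x <- enum A]); first exact: sm.
    have -> : [set x in A | j \in marked q val A ps p x] = set0.
      apply/setP=> x; rewrite !inE; apply: contraFF jin => /andP[xA jx].
      by apply/flattenP; exists (marked q val A ps p x) => //; apply: map_f; rewrite mem_enum.
    by rewrite cards0 muln0.
  by rewrite !leq_mul // leq_pexp2l // muln_gt0.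
case/allPn=> p pps /allPn[j _]; rewrite -ltnNge => /ltnW pop.
have [A1 [A1A leA1] A1P] := passive_fixes_valuation q2 Am psP pps pop.
have size_lt : size (filter (predC1 p) ps) < size ps.
  by rewrite size_filter -(count_predC (predC1 p) ps) -[X in X < _]addn0 ltn_add2l -has_count;
     apply/hasP; exists p; rewrite //= negbK.
have leA1c : #|A| <= c * #|A1|.
  by apply: leq_trans leA1 _; rewrite !leq_mul.
have leAA : #|A1| <= #|A| by apply: subset_leq_card.
have [||||| A2 [A2A1 leA2] A2P] := IH (filter (predC1 p) ps) A1.
- exact: leq_trans size_lt psn.
- exact: leq_ltn_trans leAA Am.
- by apply: leq_ltn_trans Ad; rewrite leq_exp2r.
- by apply/allP=> r; rewrite mem_filter => /andP[_ /(allP psP)].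
- exact: leq_trans (ltnW size_lt) psk.
exists A2.
  split; first exact: subset_trans A2A1 A1A.
  apply: leq_trans leA1c _.
  apply: (@leq_trans (c * (c ^ size (filter (predC1 p) ps) * #|A2|))).
    by rewrite leq_mul2l leA2 orbT.
  by rewrite mulnA -expnS leq_mul2r leq_pexp2l ?orbT.
case: A2P => [|inj]; [by left | right=> x y xA2 yA2 xy].
apply: inj => //; apply: (passive_step val0 xy).
by apply: A1P => //; apply: (subsetP A2A1).
Qed.

(** Restrict repeatedly to the multiples of a popular prime.  This stops since
    all the primes chosen divide the remaining elements, which have at most [k]
    prime divisors. *)
Lemma popular_primes (T : finType) (val : T -> nat) k Q (A : {set T}) :
  (forall x, 0 < val x) -> (forall x, x \in A -> size (primes (val x)) <= k) -> 0 < Q -> A != set0 ->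
  exists (S : seq nat) (A1 : {set T}),
    [/\ all prime S, size S <= k, A1 \subset A, #|A| <= Q ^ k * #|A1| &
     forall p, prime p -> p \notin S -> Q * #|[set x in A1 | p %| val x]| <= #|A1|].
Proof.
move=> val0 Ak Q0 An0.
suff H S (B : {set T}) : uniq S -> all prime S -> B \subset A -> B != set0 ->
    (forall p x, p \in S -> x \in B -> p %| val x) ->
    exists (S1 : seq nat) (A1 : {set T}),
    [/\ all prime S1, size S1 <= k, A1 \subset A, #|B| <= Q ^ (k - size S) * #|A1| &
     forall p, prime p -> p \notin S1 -> Q * #|[set x in A1 | p %| val x]| <= #|A1|].
  by have [//|//|//|//|//|S1 [A1 []]] := H [::] A; rewrite subn0 => *; exists S1, A1.
have [n] := ubnP (k - size S); elim: n S B => // n IH S B; rewrite ltnS => Sn uS PS BA Bn0 SB.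
have sizeS S' x : uniq S' -> all prime S' -> x \in B -> (forall p, p \in S' -> p %| val x) -> size S' <= k.
  move=> uS' PS' xB dv; apply: leq_trans (Ak x (subsetP BA x xB)).
  by apply: uniq_leq_size => // r rS; rewrite mem_primes val0 (allP PS') //= dv.
pose cand := flatten [seq primes (val x) | x <- enum B].
pose pop p := (p \notin S) && (#|B| < Q * #|[set x in B | p %| val x]|).
case: (boolP (has pop cand)) => [/hasP[p pc /andP[pS lt]]|/hasPn nopop]; last first.
  exists S, B; split=> //.
  - by have /set0Pn[x xB] := Bn0; apply: (sizeS S x) => // p pS; apply: SB.
  - by rewrite leq_pmull // expn_gt0 Q0.
  move=> p pp pS; case pc: (p \in cand); first by have := nopop p pc; rewrite /pop pS -leqNgt.
  suff -> : [set x in B | p %| val x] = set0 by rewrite cards0 muln0.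
  apply/setP=> x; rewrite !inE; apply: contraFF pc => /andP[xB px].
  apply/flattenP; exists (primes (val x)); rewrite ?mem_primes ?pp ?val0 //.
  by apply: map_f; rewrite mem_enum.
have pp : prime p by case/flattenP: pc => s /mapP[x _ ->]; rewrite mem_primes => /and3P[].
have /card_gt0P[x] : 0 < #|[set x in B | p %| val x]|.
  by rewrite lt0n; apply: contraTneq lt => ->; rewrite muln0.
rewrite inE => /andP[xB px].
have pSP : uniq (p :: S) && all prime (p :: S) by rewrite /= pS uS pp.
have [upS PpS] := andP pSP.
have szpS : size S < k.
  apply: (sizeS (p :: S) x) => // r; rewrite inE => /orP[/eqP->//|rS]; exact: SB.
have [|||||| S1 [A1 [P1 P2 P3 P4 P5]]] := IH (p :: S) [set x in B | p %| val x].
- by apply: leq_trans Sn; rewrite /= -subSn // subSS.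
- by [].
- by [].
- by apply: subset_trans BA; apply/subsetP=> y; rewrite inE => /andP[].
- by apply/set0Pn; exists x; rewrite inE xB.
- move=> r y; rewrite !inE => /orP[/eqP->|rS] /andP[yB py] //; exact: SB.
exists S1, A1; split=> //; apply: leq_trans (ltnW lt) _.
have -> : k - size S = (k - size (p :: S)).+1 by rewrite /= -subSn // subSS.
by rewrite expnS -mulnA leq_mul2l P4 orbT.
Qed.

(** The factor [c] in [2 * k * c <= Q] is there because primes outside [S] are
    known to be rare in [A1], but are needed to be rare in [A2].  A product
    [val x * val y] determines the product [n] of the passive parts, and a
    coprime factorization of [n] is given by a set of at most [2 * k] primes. *)
Lemma prodset_large (T : finType) (val : T -> nat) k c Q (S : seq nat) (A1 A2 : {set T}) (D : {fset int}) :
  (forall x, 0 < val x) -> (forall x, x \in A1 -> size (primes (val x)) <= k) ->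
  0 < c -> 0 < Q -> 2 * k * c <= Q ->
  A2 \subset A1 -> #|A1| <= c * #|A2| ->
  (forall p, prime p -> p \notin S -> Q * #|[set x in A1 | p %| val x]| <= #|A1|) ->
  {in A2 &, injective (passive val S)} ->
  (forall x y, (Posz (val x) * Posz (val y))%R \in D) ->
  #|A2| ^ 2 <= 2 * 4 ^ k * #|` D|.
Proof.
move=> val0 A1k c0 Q0 cQ A21 leA1 rare inj DD.
pose V x := primes (passive val S x).
have pas0 x : 0 < passive val S x by apply: part_gt0.
have VE x p : p \in V x -> [/\ prime p, p \notin S & p %| val x].
  by rewrite /V primes_part mem_filter mem_primes !inE => /and4P[].
have Vk x : x \in A2 -> size (V x) <= k.
  move=> /(subsetP A21)/A1k; apply: leq_trans.
  by rewrite /V primes_part size_filter count_size.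
pose E := [set r : T * T | [&& r.1 \in A2, r.2 \in A2 & ~~ has (mem (V r.2)) (V r.1)]].
have E_large : #|A2| ^ 2 <= 2 * #|E|.
  pose E' := [set r : T * T | [&& r.1 \in A2, r.2 \in A2 & has (mem (V r.2)) (V r.1)]].
  have leE' : #|E'| <= #|A2| * (k * (#|A1| %/ Q)).
    apply: card_conflicts => // j; rewrite leq_divRL // mulnC.
    have [->|[x]] := set_0Vmem [set x in A2 | j \in V x]; first by rewrite cards0 muln0.
    rewrite inE => /andP[_ /VE[pj jS _]]; apply: leq_trans (rare j pj jS).
    rewrite leq_mul2l; apply/orP; right; apply: subset_leq_card; apply/subsetP=> y.
    by rewrite !inE => /andP[/(subsetP A21)-> /VE[_ _ ->]].
  have le2 : 2 * (k * (#|A1| %/ Q)) <= #|A2|.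
    rewrite -(leq_pmul2l c0); apply: leq_trans leA1; apply: leq_trans (leq_trunc_div _ Q).
    by rewrite (mulnC _ Q) !mulnA (mulnC c) leq_mul2r -mulnA (mulnC c) mulnA cQ orbT.
  have : #|setX A2 A2| <= #|E| + #|E'|.
    rewrite -cardsUI; apply: leq_trans (leq_addr _ _).
    apply: subset_leq_card; apply/subsetP=> -[x y]; rewrite !inE /= => /andP[-> ->] /=.
    by rewrite orNb.
  rewrite cardsX; nia.
have leE : #|E| <= #|` D| * 4 ^ k.
  apply: (@card_le_fibers _ _ E (fun r => (Posz (val r.1) * Posz (val r.2))%R)) => // s.
  set R := [set r in E | _].
  have [->|[r0 r0R]] := set_0Vmem R; first by rewrite cards0.
  pose n := passive val S r0.1 * passive val S r0.2.
  have RE r : r \in R -> [/\ r.1 \in A2, r.2 \in A2, coprime (passive val S r.1) (passive val S r.2)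
       & passive val S r.1 * passive val S r.2 = n].
    rewrite !inE => /andP[/and3P[r1 r2 nh] /eqP rs]; split=> //.
      by rewrite coprime_has_primes // has_sym.
    move: r0R; rewrite !inE -rs => /andP[_ /eqP[E0]].
    by rewrite /n /passive -!partnM // E0.
  have n0 : 0 < n by rewrite muln_gt0 !pas0.
  have szn : size (primes n) <= 2 * k.
    have [r1 r2 _ _] := RE r0 r0R; apply: (@leq_trans (size (V r0.1 ++ V r0.2))).
      apply: uniq_leq_size; first exact: primes_uniq.
      by move=> p; rewrite primesM // mem_cat.
    by rewrite size_cat mul2n -addnn leq_add // Vk.
  pose g (r : T * T) := [ffun i : 'I_(2 * k) => nth 0 (primes n) i \in V r.1].
  have g_inj : {in R &, injective g}.
    move=> r r' rR r'R gg; have [rA1 rA2 _ rn] := RE r rR; have [rA1' rA2' _ rn'] := RE r' r'R.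
    have Vn r2 : r2 \in R -> {subset V r2.1 <= primes n}.
      by move=> r2R p pV; have [_ _ _ <-] := RE r2 r2R; rewrite primesM // [p \in primes _]pV.
    have VV p : p \in primes n -> (p \in V r.1) = (p \in V r'.1).
      move=> pn; have ip : index p (primes n) < 2 * k by apply: leq_trans szn; rewrite index_mem.
      by have /ffunP/(_ (Ordinal ip)) := gg; rewrite !ffunE /= nth_index.
    have VE1 : V r.1 =i V r'.1.
      move=> p; case pn: (p \in primes n); first exact: VV.
      by apply/idP/idP=> pV; [have := Vn r rR p pV | have := Vn r' r'R p pV]; rewrite pn.
    have part1 r2 : r2 \in R -> n`_\pi(passive val S r2.1) = passive val S r2.1.
      move=> r2R; have [_ _ cs <-] := RE r2 r2R; rewrite partnM // part_pnat_id ?pnat_pi //.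
      by rewrite part_p'nat ?muln1 // -coprime_pi'.
    have e1 : passive val S r.1 = passive val S r'.1.
      by rewrite -(part1 r rR) -(part1 r' r'R); apply: eq_partn => p; exact: VE1.
    have e2 : passive val S r.2 = passive val S r'.2.
      by apply/eqP; rewrite -(eqn_pmul2l (pas0 r.1)) rn e1 rn'.
    by move: (inj _ _ rA1 rA1' e1) (inj _ _ rA2 rA2' e2); case: (r) (r') => [? ?] [? ?] /= -> ->.
  rewrite -(card_in_imset g_inj); apply: leq_trans (max_card _) _.
  by rewrite card_ffun card_bool card_ord expnM.
apply: leq_trans E_large _; rewrite -mulnA leq_mul2l /=.
by rewrite (mulnC (4 ^ k)).
Qed.

(** * Choice of the parameters *)

Lemma nat_root n K : 0 < K -> 0 < n -> exists2 q, 0 < q & q ^ K <= n < q.+1 ^ K.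
Proof.
move=> K0 n0; have ex : exists q, q ^ K <= n by exists 1; rewrite exp1n.
have bd q : q ^ K <= n -> q <= n.
  apply: leq_trans; case: q => // q; rewrite -[X in X <= _]expn1 leq_pexp2l //.
case: (ex_maxnP ex bd) => q le max; exists q.
  by rewrite lt0n; apply/eqP=> q0; have := max 1; rewrite exp1n q0 => /(_ n0).
by rewrite le ltnNge; apply/negP=> /max; rewrite ltnn.
Qed.

(** The exponent [18 * k * k + 24 * k] collects the losses, where [f <= q ^ 3]
    and one round of the iteration costs [c <= q ^ 9]: the square of
    [Q ^ k * c ^ k <= q ^ (9 * k * k + 10 * k)] from the passage to dense
    subsets, and [(8 * f) ^ k <= q ^ (4 * k)] from the choice of pairs. *)
Lemma power_saving (T : finType) (val : T -> nat) (sg : int) (D1 D2 : {fset int}) k K q :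
  0 < k -> 2 < q -> K <= q -> 8 * k <= q ->
  (forall x, 0 < val x) -> injective val -> (forall x, size (primes (val x)) <= k) ->
  absz sg = 1 ->
  (forall x y, (Posz (val x) + sg * Posz (val y))%R \in D1) ->
  (forall x y, (Posz (val x) * Posz (val y))%R \in D2) ->
  0 < K -> 0 < #|T| < q.+1 ^ K ->
  #|T| ^ 2 <= (2 * 2 ^ (4 * K) + 2 * 4 ^ k) * q ^ (18 * k * k + 24 * k) * maxn #|` D1| #|` D2|.
Proof.
move=> k0 q2 Kq kq val0 val_inj valk sg1 DD1 DD2 K0 /andP[T0 TK].
pose m := q * K; pose d := 4 * K; set f := q * m.
set c := 4 * k * f.*2.+1 * f.+1.
pose Q := 2 * k * c ^ k.
have q0 : 0 < q := ltnW (ltnW q2).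
have m0 : 0 < m by rewrite muln_gt0 q0.
have c0 : 0 < c by rewrite /c !muln_gt0 k0.
have Q0 : 0 < Q by rewrite !muln_gt0 k0 expn_gt0 c0.
have Tm : #|T| < 2 ^ m.
  apply: leq_trans TK _; rewrite expnM; case: (K) => [|K']; rewrite ?expn0 // leq_exp2r //.
  exact: ltn_expl.
have Td : #|T| ^ 2 < q ^ d.
  apply: (@leq_trans ((q.+1 ^ K) ^ 2)); first by rewrite ltn_exp2r.
  have -> : d = 2 * K * 2 by rewrite /d; lia.
  rewrite (expnM q) leq_exp2r // expnM; case: (K) => [|K']; rewrite ?expn0 // leq_exp2r //.
  by rewrite -mulnn; nia.
have f3 : f <= q ^ 3 by rewrite /f /m !expnS expn0 muln1 !leq_mul.
have q34 : 8 * q ^ 3 <= q ^ 4.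
  by rewrite [q ^ 4]expnS leq_mul2r; apply/orP; right; apply: leq_trans kq; rewrite leq_pmulr.
have q3_1 : 1 < q ^ 3 by apply: (@leq_trans q); [lia | rewrite -[X in X <= _]expn1 leq_pexp2l].
have c9 : c <= q ^ 9.
  rewrite (_ : q ^ 9 = q * q ^ 4 * q ^ 4); last by rewrite -expnS -expnD.
  by rewrite /c !leq_mul //; lia.
have [S [A1 [PS Sk _ leA1 rare]]] : exists (S : seq nat) (A1 : {set T}),
    [/\ all prime S, size S <= k, A1 \subset setT, #|[set: T]| <= Q ^ k * #|A1| &
     forall p, prime p -> p \notin S -> Q * #|[set x in A1 | p %| val x]| <= #|A1|].
  apply: popular_primes => //; by rewrite -card_gt0 cardsT.
have A1T : #|A1| <= #|T| by apply: max_card.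
have A1m : #|A1| < 2 ^ m by apply: leq_ltn_trans A1T Tm.
have A1d : #|A1| ^ 2 < q ^ d by apply: leq_ltn_trans Td; rewrite leq_exp2r.
have [A2 [A21 leA2] A2P] := sumset_large_or_passive_inj q2 m0 val0 val_inj sg1 A1m A1d PS Sk DD1.
rewrite -/f -/c in leA2 A2P.
have leA2k : #|A1| <= c ^ k * #|A2|.
  by apply: leq_trans leA2 _; rewrite leq_mul2r leq_pexp2l ?orbT.
have leT : #|T| <= Q ^ k * c ^ k * #|A2|.
  by rewrite -cardsT; apply: leq_trans leA1 _; rewrite -mulnA leq_mul2l leA2k orbT.
set Mx := maxn _ _.
have le_sq : #|A2| ^ 2 <= (2 * 2 ^ d + 2 * 4 ^ k) * q ^ (4 * k) * Mx.
  case: A2P => [le|inj].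
    apply: leq_trans le _; rewrite leq_mul ?leq_maxl // -mulnA (mulnC _ (2 ^ d)) mulnA.
    apply: leq_mul; first exact: leq_addr.
    rewrite expnM; case: (k) => [|k']; rewrite ?expn0 // leq_exp2r //; lia.
  apply: leq_trans (prodset_large val0 (fun x _ => valk x) _ Q0 _ A21 leA2k rare inj DD2) _.
  - by rewrite expn_gt0 c0.
  - by [].
  rewrite leq_mul ?leq_maxr // -[X in X <= _]muln1 leq_mul ?leq_addl // expn_gt0 q0 //.
have leQ : Q ^ k * c ^ k <= q ^ (9 * k * k + 10 * k).
  have Qq : Q <= q ^ (9 * k + 1).
    rewrite /Q addn1 expnS leq_mul //; first lia.
    by rewrite expnM; case: (k) => [|k']; rewrite ?expn0 // leq_exp2r.
  rewrite -expnMn.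
  have -> : 9 * k * k + 10 * k = (9 * k + 1 + 9) * k by lia.
  rewrite (expnM q); case: (k) Qq => [|k'] Qq; rewrite ?expn0 // leq_exp2r // expnD leq_mul //.
apply: (@leq_trans ((Q ^ k * c ^ k * #|A2|) ^ 2)); first by rewrite leq_exp2r.
rewrite expnMn.
apply: (@leq_trans ((q ^ (9 * k * k + 10 * k)) ^ 2 * ((2 * 2 ^ d + 2 * 4 ^ k) * q ^ (4 * k) * Mx))).
  by rewrite leq_mul // leq_exp2r.
have -> : 18 * k * k + 24 * k = (9 * k * k + 10 * k) * 2 + 4 * k by lia.
rewrite [q ^ (_ * 2 + _)]expnD (expnM q _ 2) /d.
by rewrite eq_leq // mulnA; congr (_ * _); rewrite mulnCA.
Qed.

(** [q] is the integral part of the [K]-th root of the size, with [K] so large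
    that the [e]-th power of the loss is at most the size.  Small [q] means
    bounded size, which is absorbed in the constant. *)
Lemma few_primes_sum_product k e : 0 < k -> 0 < e -> exists2 C, 0 < C &
  forall (T : finType) (val : T -> nat) (sg : int) (D1 D2 : {fset int}),
  (forall x, 0 < val x) -> injective val -> (forall x, size (primes (val x)) <= k) ->
  absz sg = 1 ->
  (forall x y, (Posz (val x) + sg * Posz (val y))%R \in D1) ->
  (forall x y, (Posz (val x) * Posz (val y))%R \in D2) ->
  #|T| ^ (2 * e).-1 <= (C * maxn #|` D1| #|` D2|) ^ e.
Proof.
move=> k0 e0; pose w := 18 * k * k + 24 * k; pose K := e * w.
have w0 : 0 < w by rewrite /w addn_gt0 !muln_gt0 k0.
have K0 : 0 < K by rewrite muln_gt0 e0.
pose q0 := K + 8 * k + 3.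
pose C1 := 2 * 2 ^ (4 * K) + 2 * 4 ^ k.
exists (C1 + (q0 ^ K) ^ 2); first by rewrite addn_gt0 addn_gt0 muln_gt0 expn_gt0.
move=> T val sg D1 D2 val0 val_inj valk sg1 DD1 DD2.
case: (posnP #|T|) => [->|T0]; first by rewrite exp0n //; lia.
have [q qgt0 /andP[qle qlt]] := nat_root K0 T0.
set Mx := maxn _ _.
case: (ltnP q q0) => [small|large].
  have Mx0 : 0 < Mx.
    have /card_gt0P[x _] := T0.
    by rewrite leq_max cardfs_gt0; apply/orP; left; apply/fset0Pn; eexists; exact: (DD1 x x).
  have Tq : #|T| <= q0 ^ K.
    by apply: leq_trans (ltnW qlt) _; rewrite leq_exp2r.
  apply: (@leq_trans (#|T| ^ (2 * e))); first by rewrite leq_pexp2l // leq_pred.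
  rewrite expnM leq_exp2r //; apply: (@leq_trans ((q0 ^ K) ^ 2)); first by rewrite leq_exp2r.
  by rewrite -[X in X <= _]muln1 leq_mul // leq_addl.
have le2 : #|T| ^ 2 <= C1 * q ^ w * Mx.
  by apply: (@power_saving T val sg D1 D2 k K q) => //; rewrite ?T0 //; rewrite /q0 in large; lia.
rewrite -(leq_pmul2l T0) -expnS prednK ?muln_gt0 ?e0 // expnM.
apply: (@leq_trans ((C1 * q ^ w * Mx) ^ e)); first by rewrite leq_exp2r.
rewrite mulnAC expnMn mulnC leq_mul //; first by rewrite -expnM mulnC.
by rewrite leq_exp2r // leq_mul // leq_addr.
Qed.

(** * Sets of integers *)

Local Open Scope fset_scope.
Local Open Scope nat_scope.

Lemma one_sign (A : {fset int}) : (forall n, n \in A -> n != 0%R) ->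
  exists2 s : int, s = 1%R \/ s = (-1)%R &
    #|` A| <= 2 * #|` [fset x in A | (0 < s * x)%R]|.
Proof.
move=> A0; set P := [fset x in A | (0 < 1 * x)%R]; set N := [fset x in A | (0 < -1 * x)%R].
have le : #|` A| <= #|` P| + #|` N|.
  apply: (@leq_trans #|` P `|` N|); last by rewrite cardfsU leq_subr.
  apply/fsubset_leq_card/fsubsetP=> x xA; rewrite !inE xA /= mul1r mulN1r oppr_gt0.
  by have := A0 x xA; rewrite neq_lt orbC.
by case: (leqP #|` P| #|` N|) => PN; [exists (-1)%R | exists 1%R];
   rewrite -/P -/N; try (by [left | right]); lia.
Qed.

(** At least half of the elements have the same sign [s]; their absolute values enter
    the result for natural numbers, whose sums and differences are those of the
    integers multiplied by [s]. *)
Lemma few_primes_fset k : 0 < k -> exists2 C, 0 < C &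
  forall (A D : {fset int}) (sg : int),
  (forall n, n \in A -> n != 0%R) -> (forall n, n \in A -> omega n <= k) ->
  absz sg = 1 -> (forall a b, a \in A -> b \in A -> (a + sg * b)%R \in D) ->
  #|` A| ^ 7 <= (C * maxn #|` D| #|` prodset A A|) ^ 4.
Proof.
move=> k0; have [C C0 HC] := @few_primes_sum_product k 4 k0 isT.
exists (4 * C); first by rewrite muln_gt0.
move=> A D sg A0 Ak sg1 AD.
have [s s1 leA] := one_sign A0; set A1 := [fset x in A | _] in leA.
have ss : (s * s = 1)%R by case: s1 => ->.
have A1A (x : A1) : fsval x \in A by have := fsvalP x; rewrite !inE => /andP[].
pose val (x : A1) := absz (fsval x).
have valE (x : A1) : Posz (val x) = (s * fsval x)%R.
  have := fsvalP x; rewrite !inE => /andP[_ pos]; rewrite -(gtz0_abs pos) /val abszM.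
  by case: s1 => ->; rewrite mul1n.
pose D1 := [fset (s * d)%R | d in D].
have card_D1 : #|` D1| <= #|` D| by exact: leq_imfset_card.
have le : #|{: A1}| ^ 7 <= (C * maxn #|` D1| #|` prodset A A|) ^ 4.
  apply: (HC _ val sg) => //.
  - by move=> x; rewrite /val absz_gt0 A0.
  - move=> x y xy; apply: val_inj; have : Posz (val x) = Posz (val y) by rewrite xy.
    by rewrite !valE => /(congr1 (fun z => s * z)%R); rewrite !mulrA ss !mul1r.
  - by move=> x; exact: (Ak _ (A1A x)).
  - move=> x y; rewrite !valE mulrCA -mulrDr; apply/imfsetP.
    by exists (fsval x + sg * fsval y)%R; rewrite //= AD.
  - move=> x y; rewrite !valE mulrACA ss mul1r.
    by apply/imfset2P; exists (fsval x) => //=; exists (fsval y).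
rewrite (cardfE A1) in leA.
apply: (@leq_trans ((2 * #|{: A1}|) ^ 7)); first by rewrite leq_exp2r.
rewrite expnMn -mulnA expnMn leq_mul //; apply: leq_trans le _.
by rewrite leq_exp2r // leq_mul // geq_max leq_maxr andbT (leq_trans card_D1) ?leq_maxl.
Qed.

Local Open Scope ring_scope.

Lemma powR_le_of_expn_le (R : realType) (n m C : nat) (eps : R) : 0 < eps -> (0 < n)%N -> (0 < C)%N ->
  (n ^ 7 <= (C * m) ^ 4)%N -> C%:R^-1 * (n%:R `^ (12 / 7 - eps)) <= m%:R :> R.
Proof.
move=> eps0 n0 C0 le.
have n1 : 1 <= n%:R :> R by rewrite ler1n.
rewrite ler_pdivrMl ?ltr0n // -natrM.
apply: (@le_trans _ _ (n%:R `^ (7 / 4))).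
  by apply: ler_powR => //; lra.
rewrite -(@ler_pXn2r _ 4) ?nnegrE ?powR_ge0 ?ler0n //.
rewrite -powR_mulrn ?powR_ge0 // -powRrM divfK ?pnatr_eq0 // powR_mulrn ?ler0n //.
by rewrite -!natrX ler_nat.
Qed.

Theorem theorem2 (R : realType) (k : nat) (hk : (1 <= k)%N)
    (eps : R) (heps : 0 < eps) :
  exists2 c : R, 0 < c &
    forall A : {fset int},
      A != fset0 ->
      (forall n : int, n \in A -> n != 0) ->
      (forall n : int, n \in A -> (omega n <= k)%N) ->
      c * (#|` A|%:R `^ (12 / 7 - eps))
        <= (maxn #|` sumset A A| #|` prodset A A|)%:R
      /\
      c * (#|` A|%:R `^ (12 / 7 - eps))
        <= (maxn #|` diffset A A| #|` prodset A A|)%:R.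
Proof.
have [C C0 HC] := few_primes_fset hk.
exists C%:R^-1; first by rewrite invr_gt0 ltr0n.
move=> A An0 A0 Ak; have n0 : (0 < #|` A|)%N by rewrite cardfs_gt0.
split; apply: powR_le_of_expn_le => //.
  apply: (HC A _ 1) => // a b aA bA; rewrite mul1r.
  by apply/imfset2P; exists a => //=; exists b.
apply: (HC A _ (-1)) => // a b aA bA; rewrite mulN1r.
by apply/imfset2P; exists a => //=; exists b.
Qed.
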